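(* Let $\mathbb{F}$ be a finite field and let $\mathscr{C}$ be an arbitrary linear code over $\mathbb{F}$ in which the adversary (eavesdropper) observes $$\mathbf{C}=A\mathbf{M}+B\mathbf{K}+G\mathbf{W},$$ where $A,B,G$ are fixed matrices over $\mathbb{F}$ of compatible sizes, and $\mathbf{M}$, $\mathbf{K}$, $\mathbf{W}$ are mutually independent random column vectors (messages, keys, private randomness), each with independent and uniformly distributed entries in $\mathbb{F}$. Suppose that at least one of the following strong secrecy constraints holds: (i) $I(\mathbf{M};\mathbf{C})\leq\epsilon$ for some $\epsilon<1$; or (ii) $\lVert p_{\mathbf{M}\mathbf{C}}-p_{\mathbf{M}}p_{\mathbf{C}}\rVert_1\leq\epsilon$ for some $\epsilon<1/2$. Then the code $\mathscr{C}$ is also perfectly secure, i.e., $I(\mathbf{M};\mathbf{C})=0$.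
   Context: All logarithms (in entropy and mutual information $I(\cdot;\cdot)$) are in base two. The total variation distance between two pmfs $p_X,q_X$ on the same finite set is $\|p_X-q_X\|_1=\frac12\sum_x|p_X(x)-q_X(x)|$. Here $p_{\mathbf{M}\mathbf{C}}$ denotes the joint pmf of $(\mathbf{M},\mathbf{C})$ and $p_{\mathbf{M}}p_{\mathbf{C}}$ the product of its marginals. Setting: in linear network coding over a finite field $\mathbb{F}$, every message $M_i$, key $K_i$ and private randomness variable $W_i$ is a string of independent uniform symbols of $\mathbb{F}$, all mutually independent, and all coding operations in the network are linear over $\mathbb{F}$; consequently the eavesdropper's total observation has the form $\mathbf{C}=A\mathbf{M}+B\mathbf{K}+G\mathbf{W}$, where $\mathbf{M},\mathbf{K},\mathbf{W}$ are the column vectors obtained by stacking all messages, all keys and all private randomness respectively. Perfect secrecy means that the conditional pmf $p(\mathbf{C}=\mathbf{c}\mid\mathbf{M}=\mathbf{m})$ does not depend on $\mathbf{m}$, for any $\mathbf{c}$ (equivalently, for uniform $\mathbf{M}$ as here, $I(\mathbf{M};\mathbf{C})=0$). *)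

(* Defs.v *)
From HB Require Import structures.
From mathcomp Require Import all_boot all_order all_algebra.
From mathcomp Require Import all_classical all_reals all_analysis.

Set Implicit Arguments.
Unset Strict Implicit.
Unset Printing Implicit Defensive.

Import Order.TTheory GRing.Theory Num.Theory.
Local Open Scope classical_set_scope.
Local Open Scope ring_scope.

Definition log2 (R : realType) (x : R) : R := ln x / ln 2.

(* A random variable with values in a finite alphabet A, i.e. a function that
   is measurable for the discrete sigma-algebra on A: since A is finite, it is
   enough to ask this of singletons. *)
Definition finite_rv (d : measure_display) (T : measurableType d) (A : finType)
    (X : T -> A) : Prop :=
  forall a : A, measurable [set t | X t = a].

Definition rv_pmf (d : measure_display) (T : measurableType d) (R : realType)
    (P : probability T R) (A : finType) (X : T -> A) (a : A) : R :=
  fine (P [set t | X t = a]).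

Definition joint_pmf (d : measure_display) (T : measurableType d)
    (R : realType) (P : probability T R) (A B : finType)
    (X : T -> A) (Y : T -> B) : A * B -> R :=
  rv_pmf P (fun t => (X t, Y t)).

Definition prod_pmf (R : realType) (A B : finType) (p : A -> R) (q : B -> R) :
    A * B -> R :=
  fun ab => p ab.1 * q ab.2.

(* p(x | y); only meaningful when p(y) <> 0. *)
Definition cond_pmf (d : measure_display) (T : measurableType d)
    (R : realType) (P : probability T R) (A B : finType)
    (X : T -> A) (Y : T -> B) (a : A) (b : B) : R :=
  joint_pmf P X Y (a, b) / rv_pmf P Y b.

(* The leading factor gives the summand the value 0 when
   p(a, b) = 0; when p(a, b) > 0, so is the denominator. *)
Definition mutual_info (d : measure_display) (T : measurableType d)
    (R : realType) (P : probability T R) (A B : finType)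
    (X : T -> A) (Y : T -> B) : R :=
  \sum_(ab : A * B)
    joint_pmf P X Y ab *
    log2 (joint_pmf P X Y ab / prod_pmf (rv_pmf P X) (rv_pmf P Y) ab).

Definition tv_dist (R : realType) (A : finType) (p q : A -> R) : R :=
  2^-1 * \sum_(a : A) `|p a - q a|.

(* Mutual independence of discrete random variables as factorization of the
   joint pmf; summing out coordinates gives the same for every subfamily. *)
Definition mutually_independent3 (d : measure_display) (T : measurableType d)
    (R : realType) (P : probability T R) (A B D : finType)
    (X : T -> A) (Y : T -> B) (Z : T -> D) : Prop :=
  forall a b e,
    rv_pmf P (fun t => (X t, Y t, Z t)) (a, b, e) =
    rv_pmf P X a * rv_pmf P Y b * rv_pmf P Z e.

Definition independent_entries (d : measure_display) (T : measurableType d)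
    (R : realType) (P : probability T R) (A : finType) (n : nat)
    (X : T -> 'cV[A]_n) : Prop :=
  forall v : 'cV[A]_n,
    rv_pmf P X v = \prod_(i < n) rv_pmf P (fun t => X t i 0) (v i 0).

Definition uniform_entries (d : measure_display) (T : measurableType d)
    (R : realType) (P : probability T R) (A : finType) (n : nat)
    (X : T -> 'cV[A]_n) : Prop :=
  forall (i : 'I_n) (a : A), rv_pmf P (fun t => X t i 0) a = #|A|%:R^-1.

Definition uniform_string (d : measure_display) (T : measurableType d)
    (R : realType) (P : probability T R) (A : finType) (n : nat)
    (X : T -> 'cV[A]_n) : Prop :=
  [/\ finite_rv X, independent_entries P X & uniform_entries P X].

Definition observation (F : finFieldType) (nM nK nW nC : nat)
    (A : 'M[F]_(nC, nM)) (B : 'M[F]_(nC, nK)) (G : 'M[F]_(nC, nW))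
    (T : Type) (M : T -> 'cV[F]_nM) (K : T -> 'cV[F]_nK) (W : T -> 'cV[F]_nW)
    (t : T) : 'cV[F]_nC :=
  A *m M t + B *m K t + G *m W t.

(* p(C = c | M = m) does not depend on m, over the m where it is defined. *)
Definition perfectly_secure (d : measure_display) (T : measurableType d)
    (R : realType) (P : probability T R) (A B : finType)
    (M : T -> A) (C : T -> B) : Prop :=
  forall (c : B) (m m' : A), rv_pmf P M m != 0 -> rv_pmf P M m' != 0 ->
    cond_pmf P C M c m = cond_pmf P C M c m'.

(* Main.v *)
Require Import Defs.
From HB Require Import structures.
From mathcomp Require Import all_boot all_order all_algebra.
From mathcomp Require Import all_classical all_reals all_analysis.

Set Implicit Arguments.
Unset Strict Implicit.
Unset Printing Implicit Defensive.

Import Order.TTheory GRing.Theory Num.Theory.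
Local Open Scope classical_set_scope.
Local Open Scope ring_scope.

(** The joint pmf of [(M, C)] is proportional to the number [N m c] of
    randomness values [k] with [a m + f k = c], where [a] and [f] are additive.
    Each [N m c] is zero or the order of the kernel of [f]. If the image of [f]
    contains the image of [a], then [N m c] does not depend on [m]. Otherwise
    pick [m0] with [a m0] outside the image of [f]: since [m] and [m + m0]
    cannot both explain [c], at most half of the messages are compatible with
    any observation. The joint pmf is then at least twice the product of its
    marginals on its support, which forces a mutual information of at least one
    bit and a total variation distance of at least 1/2. *)

(** Joins the finite and the additive structure of a product, so that pairs of keys and private
    randomness can form the domain [V] of [f] below. *)
HB.instance Definition _ (U V : finZmodType) := GRing.Zmodule.on (U * V)%type.

Definition fibre_card (A : finType) (B : eqType) (g : A -> B) (b : B) : nat :=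
  #|[pred x | g x == b]|.

Section Counting.
Variables (U V Y : finZmodType) (a : U -> Y) (f : V -> Y).
Hypotheses (aD : {morph a : x y / x + y}) (fD : {morph f : x y / x + y}).

Let N m := fibre_card (fun k => a m + f k).
Let H := fibre_card (fun x : U * V => a x.1 + f x.2).

(** If [j] solves the equation for [m'], translation by [k - j] injects the solutions for [m'] into
    those for [m]; if no [j] does, the left side is 0. *)
Lemma fibre_card_le m m' c k : a m + f k = c -> (N m' c <= N m c)%N.
Proof.
move=> mk.
have [j /eqP mj|N0] := pickP [pred j | a m' + f j == c]; last first.
  by rewrite /N /fibre_card (eq_card0 N0).
rewrite /N /fibre_card -(fintype.card_image (addIr (k - j))) subset_leq_card //.
apply/fintype.subsetP => _ /fintype.imageP[i /[!inE] /eqP mi ->].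
have /addrI fij : a m' + f i = a m' + f j by rewrite mi mj.
by rewrite fD fij -fD [j + _]addrC subrK mk.
Qed.

Lemma fibre_card_sum c : H c = (\sum_(m : U) N m c)%N.
Proof.
rewrite /H /fibre_card -sum1_card.
rewrite (eq_bigl (fun x => true && (a x.1 + f x.2 == c))) //.
rewrite -(pair_big_dep xpredT (fun m k => a m + f k == c) (fun _ _ => 1%N)) /=.
by apply: eq_bigr => m _; rewrite /N /fibre_card -sum1_card.
Qed.

(** For uniform inputs, [N m c] and [H c] are the joint pmf and the pmf of the observation, both
    scaled by [#|U| * #|V|]. The alternatives thus compare the joint pmf with the product of its
    marginals. *)
Lemma fibre_dichotomy :
  (forall m c, H c = (#|U| * N m c)%N) \/
  (forall m c, N m c != 0%N -> (2 * H c <= #|U| * N m c)%N).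
Proof.
have [[m0 m0f]|af] := pselect (exists m0, forall k, a m0 != f k); [right|left].
  move=> m c /eqP; rewrite fibre_card_sum => Nmc.
  have [k /eqP mk|N0] := pickP [pred k | a m + f k == c]; last first.
    by case: Nmc; apply: eq_card0.
  (* Translating one copy of the sum by [m0] pairs [N m' c] with [N (m' + m0) c]; it suffices to
     bound each pair by [N m c]. *)
  rewrite mul2n -addnn {2}(reindex_inj (addIr m0)) -big_split /=.
  rewrite -sum_nat_const leq_sum // => m' _.
  have [k1 /eqP k1c|N0] := pickP [pred k | a m' + f k == c]; last first.
    by rewrite {1}/N /fibre_card (eq_card0 N0) add0n (fibre_card_le _ mk).
  (* A solution [k2] for [m' + m0] would give [a m0 = f (k1 - k2)], against the choice of [m0]. *)
  rewrite {2}/N /fibre_card eq_card0 ?addn0 ?(fibre_card_le _ mk) // => k2 /=.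
  apply/negbTE/eqP; rewrite -k1c aD -addrA => /addrI k2c.
  have /eqP[] := m0f (k1 - k2).
  by apply: (addIr (f k2)); rewrite -fD subrK.
move=> m c; rewrite fibre_card_sum -sum_nat_const; apply: eq_bigr => m' _.
(* Here [a (m1 - m2)] equals some [f j], and [j + k] is a solution for [m2]. *)
have solve m1 m2 k : a m1 + f k = c -> exists k', a m2 + f k' = c.
  move=> m1k; apply: contrapT => nk; apply: af; exists (m1 - m2) => j.
  apply/eqP => mj; apply: nk; exists (j + k).
  by rewrite fD -mj addrA -aD [m2 + _]addrC subrK.
have le m1 m2 : (N m1 c <= N m2 c)%N.
  have [k /eqP m1k|N0] := pickP [pred k | a m1 + f k == c]; last first.
    by rewrite {1}/N /fibre_card (eq_card0 N0).
  by have [k' m2k'] := solve _ m2 _ m1k; exact: fibre_card_le m2k'.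
by apply/eqP; rewrite eqn_leq !le.
Qed.

End Counting.

Section Pmf.
Context d (T : measurableType d) (R : realType) (P : probability T R).
Implicit Types A B : finType.

Lemma rv_pmf_ge0 A (X : T -> A) a : 0 <= rv_pmf P X a.
Proof. exact: fine_ge0. Qed.

Lemma finite_rv_pair A B (X : T -> A) (Y : T -> B) :
  finite_rv X -> finite_rv Y -> finite_rv (fun t => (X t, Y t)).
Proof.
move=> mX mY [a b].
rewrite (_ : [set _ | _] = [set t | X t = a] `&` [set t | Y t = b]).
  exact: measurableI.
by apply/seteqP; split => t /= [-> ->].
Qed.

Lemma bigcup_preimage A B (X : T -> A) (g : A -> B) b :
  [set t | g (X t) = b] =
  \bigcup_(a in [set` [pred a | g a == b]]) [set t | X t = a].
Proof.
apply/seteqP; split => [t /= gX|t [a /= /[!inE] /eqP ga ->] //].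
by exists (X t) => //=; rewrite inE gX.
Qed.

Lemma finite_rv_comp A B (X : T -> A) (g : A -> B) :
  finite_rv X -> finite_rv (fun t => g (X t)).
Proof.
move=> mX b; rewrite bigcup_preimage.
by apply: fin_bigcup_measurable => *; [exact: finite_finset|exact: mX].
Qed.

Lemma rv_pmf_comp A B (X : T -> A) (g : A -> B) b : finite_rv X ->
  rv_pmf P (fun t => g (X t)) b = \sum_(a | g a == b) rv_pmf P X a.
Proof.
move=> mX; rewrite /rv_pmf sum_fine; last first.
  by move=> a _; apply: fin_num_measure; exact: mX.
congr fine; rewrite bigcup_preimage measure_fin_bigcup //.
- rewrite -(@bigfs _ _ _ _ (index_enum A)) ?index_enum_uniq // => a _.
  by rewrite mem_index_enum.
- by move=> a a' _ _ [t [/= <- <-]].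
Qed.

Lemma sum_rv_pmf A (X : T -> A) : finite_rv X -> \sum_a rv_pmf P X a = 1.
Proof.
(* The total mass is the pmf of a constant map to [unit]. *)
move=> mX; have := rv_pmf_comp (fun=> tt) tt mX; rewrite /= => <-.
rewrite /rv_pmf (_ : [set _ | _] = setT) ?probability_setT //.
exact/seteqP.
Qed.

Section Joint.
Variables (A B : finType) (X : T -> A) (Y : T -> B).
Hypothesis mXY : finite_rv (fun t => (X t, Y t)).

Let p := joint_pmf P X Y.
Let q := prod_pmf (rv_pmf P X) (rv_pmf P Y).

Lemma joint_pmf_le_margl a b : p (a, b) <= rv_pmf P X a.
Proof.
rewrite [leRHS](rv_pmf_comp fst a mXY) (bigD1 (a, b)) //= lerDl.
by apply: sumr_ge0 => ab _; exact: rv_pmf_ge0.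
Qed.

Lemma joint_pmf_le_margr a b : p (a, b) <= rv_pmf P Y b.
Proof.
rewrite [leRHS](rv_pmf_comp snd b mXY) (bigD1 (a, b)) //= lerDl.
by apply: sumr_ge0 => ab _; exact: rv_pmf_ge0.
Qed.

Lemma sum_prod_pmf : \sum_ab q ab = 1.
Proof.
rewrite -(pair_bigA _ (fun a b => rv_pmf P X a * rv_pmf P Y b)) /=.
rewrite -big_distrlr /= !sum_rv_pmf ?mulr1 //.
- exact: (finite_rv_comp snd mXY).
- exact: (finite_rv_comp fst mXY).
Qed.

Lemma mutual_info_indep : p =1 q -> mutual_info P X Y = 0.
Proof.
move=> pq; rewrite /mutual_info big1 // => ab _; rewrite -/p -/q -pq.
have [->|p0] := eqVneq (p ab) 0; first by rewrite mul0r.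
by rewrite divff // /log2 ln1 mul0r mulr0.
Qed.

Hypothesis le_joint : forall ab, p ab != 0 -> 2 * q ab <= p ab.

(** On the support of [p] the logarithm is at least [log2 2 = 1], so the sum dominates the total
    mass of [p]. *)
Lemma mutual_info_ge1 : 1 <= mutual_info P X Y.
Proof.
rewrite -(sum_rv_pmf mXY); apply: ler_sum => -[a b] _.
rewrite -/(joint_pmf P X Y) -/p -/q.
have [->|p0] := eqVneq (p (a, b)) 0; first by rewrite mul0r.
have p_gt0 : 0 < p (a, b) by rewrite lt0r p0 rv_pmf_ge0.
(* Rules out a zero denominator, for which the quotient would be 0 by convention. *)
have q_gt0 : 0 < q (a, b).
  apply: mulr_gt0; apply: lt_le_trans p_gt0 _.
  - exact: joint_pmf_le_margl.
  - exact: joint_pmf_le_margr.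
rewrite ler_peMr ?rv_pmf_ge0 // /log2 ler_pdivlMr ?ln_gt0 ?ltr1n // mul1r.
by rewrite ler_ln ?posrE ?divr_gt0 // ler_pdivlMr // le_joint.
Qed.

(** Pointwise [|p - q| >= q]: on the support of [p] because [p - q >= q], elsewhere because [p = 0].
    And [q] has total mass 1. *)
Lemma tv_dist_ge_half : 2^-1 <= tv_dist p q.
Proof.
rewrite /tv_dist ler_peMr ?invr_ge0 // -sum_prod_pmf; apply: ler_sum => ab _.
have [->|p0] := eqVneq (p ab) 0; first by rewrite sub0r normrN ler_norm.
by apply: le_trans (ler_norm _); rewrite lerBrDr -mulr2n -mulr_natl le_joint.
Qed.

End Joint.

(** Every pmf involved is a solution count over a power-free constant: [N m c] and [H c] over
    [#|U| * #|V|], and 1 over [#|U|] for [M]. Clearing denominators leaves the counting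
    dichotomy. *)
Lemma additive_secrecy_dichotomy (U V Y : finZmodType) (a : U -> Y) (f : V -> Y)
    (M : T -> U) (K : T -> V) (C := fun t => a (M t) + f (K t)) :
  {morph a : x y / x + y} -> {morph f : x y / x + y} ->
  finite_rv (fun t => (M t, K t)) ->
  (forall x, joint_pmf P M K x = #|{: U * V}|%:R^-1) ->
  joint_pmf P M C =1 prod_pmf (rv_pmf P M) (rv_pmf P C) \/
  forall mc, joint_pmf P M C mc != 0 ->
    2 * prod_pmf (rv_pmf P M) (rv_pmf P C) mc <= joint_pmf P M C mc.
Proof.
move=> aD fD mMK unif.
have U_gt0 : (0 : R) < #|U|%:R by rewrite ltr0n; apply/card_gt0P; exists 0.
have V_gt0 : (0 : R) < #|V|%:R by rewrite ltr0n; apply/card_gt0P; exists 0.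
have pC c : rv_pmf P C c =
    (fibre_card (fun x : U * V => a x.1 + f x.2) c)%:R / (#|U|%:R * #|V|%:R).
  rewrite (rv_pmf_comp (fun x => a x.1 + f x.2) c mMK).
  rewrite (eq_bigr _ (fun x _ => unif x)) sumr_const card_prod natrM.
  by rewrite -[LHS]mulr_natl.
have pM m : rv_pmf P M m = #|U|%:R^-1.
  rewrite (rv_pmf_comp fst m mMK) (eq_bigr _ (fun x _ => unif x)).
  rewrite (eq_bigl (fun x : U * V => (x.1 == m) && true)); last first.
    by move=> x; rewrite andbT.
  rewrite -(pair_big (pred1 m) xpredT (fun _ _ => #|{: U * V}|%:R^-1)) /=.
  rewrite big_pred1_eq sumr_const card_prod natrM -[LHS]mulr_natl.
  by rewrite invfM mulrCA divff ?mulr1 // gt_eqF.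
have pMC m c : joint_pmf P M C (m, c) =
    (fibre_card (fun k => a m + f k) c)%:R / (#|U|%:R * #|V|%:R).
  rewrite /joint_pmf (rv_pmf_comp (fun x => (x.1, a x.1 + f x.2)) (m, c) mMK).
  rewrite (eq_bigr _ (fun x _ => unif x)).
  rewrite -(pair_big_dep (pred1 m) (fun m k => a m + f k == c)
    (fun _ _ => #|{: U * V}|%:R^-1)) /=.
  by rewrite big_pred1_eq sumr_const card_prod natrM -[LHS]mulr_natl.
case: (fibre_dichotomy aD fD) => N; [left|right] => -[m c];
  rewrite /prod_pmf /= pMC pM pC.
  by rewrite (N m) natrM mulrA mulKf ?gt_eqF.
rewrite mulf_eq0 negb_or pnatr_eq0 => /andP[/N Nmc _].
rewrite !mulrA ler_pM2r ?invr_gt0 ?mulr_gt0 //.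
by rewrite mulrAC ler_pdivrMr // -!natrM ler_nat [leqRHS]mulnC.
Qed.

Lemma uniform_string_pmf A n (X : T -> 'cV[A]_n) v :
  uniform_string P X -> rv_pmf P X v = #|{: 'cV[A]_n}|%:R^-1.
Proof.
case=> _ -> unifX; rewrite (eq_bigr _ (fun i _ => unifX i (v i 0))).
by rewrite prodr_const card_ord card_mx muln1 natrX exprVn.
Qed.

End Pmf.

Theorem theorem1 (R : realType) (d : measure_display) (T : measurableType d)
    (P : probability T R) (F : finFieldType) (nM nK nW nC : nat)
    (A : 'M[F]_(nC, nM)) (B : 'M[F]_(nC, nK)) (G : 'M[F]_(nC, nW))
    (M : T -> 'cV[F]_nM) (K : T -> 'cV[F]_nK) (W : T -> 'cV[F]_nW)
    (C := observation A B G M K W)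
    (unifM : uniform_string P M)
    (unifK : uniform_string P K)
    (unifW : uniform_string P W)
    (indep : mutually_independent3 P M K W)
    (secure :
      (exists eps : R, eps < 1 /\ mutual_info P M C <= eps) \/
      (exists eps : R, eps < 2^-1 /\
        tv_dist (joint_pmf P M C) (prod_pmf (rv_pmf P M) (rv_pmf P C))
          <= eps)) :
  perfectly_secure P M C /\ mutual_info P M C = 0.
Proof.
case: (unifM) (unifK) (unifW) => mM _ _ [mK _ _] [mW _ _].
(* Keys and private randomness are merged into one uniform source that enters through a single
   additive map [f]. *)
pose KW t := (K t, W t).
pose a (m : 'cV[F]_nM) := A *m m.
pose f (kw : 'cV[F]_nK * 'cV[F]_nW) := B *m kw.1 + G *m kw.2.
have aD : {morph a : x y / x + y} by move=> x y; exact: mulmxDr.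
have fD : {morph f : x y / x + y}.
  by move=> x y; rewrite /f !mulmxDr addrACA.
have mMKW : finite_rv (fun t => (M t, KW t)).
  by do 2!apply: finite_rv_pair => //.
have unif x : joint_pmf P M KW x =
    #|{: 'cV[F]_nM * ('cV[F]_nK * 'cV[F]_nW)}|%:R^-1.
  case: x => m [k w]; have := indep m k w.
  rewrite !uniform_string_pmf // !card_prod !natrM !invfM mulrA => <-.
  by rewrite /KW; congr (fine (P _)); apply/seteqP; split => t /= [-> -> ->].
have CE : C = fun t => a (M t) + f (KW t).
  by apply/funext => t; rewrite /C /observation -addrA.
have mMC : finite_rv (fun t => (M t, C t)).
  by rewrite CE; exact: (finite_rv_comp (fun x => (x.1, a x.1 + f x.2)) mMKW).
have := additive_secrecy_dichotomy aD fD mMKW unif; rewrite -CE => -[pq|ple].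
- split; last exact: mutual_info_indep.
  move=> c m m' m0 m'0.
  have joint_swap x : joint_pmf P C M (c, x) = joint_pmf P M C (x, c).
    by congr (fine (P _)); apply/seteqP; split => t /= [-> ->].
  (* Both conditional pmfs reduce to [rv_pmf P C c], as the marginals of [M] at [m] and [m'] are
     nonzero. *)
  rewrite /cond_pmf !joint_swap !pq /prod_pmf /=.
  by rewrite ![_ * rv_pmf P C c]mulrC !mulfK.
(* A joint pmf at least twice the product on its support contradicts either secrecy bound. *)
- case: secure => -[eps [eps_lt le_eps]].
  + by have := le_trans (mutual_info_ge1 mMC ple) le_eps; rewrite leNgt eps_lt.
  + by have := le_trans (tv_dist_ge_half mMC ple) le_eps; rewrite leNgt eps_lt.
Qed.
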